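(* Let $\Phi=(\{E_i\}_{i=0}^d;\{E^*_i\}_{i=0}^d)$ be a symmetric idempotent system on $V$, with associated elements $A_i$, $A^*_i$ of $\mathrm{End}(V)$. For $0\le i\le d$ the following hold: (i) $A_iE^*_0E_0=E^*_iE_0$; (ii) $A^*_iE_0E^*_0=E_iE^*_0$; (iii) $E_0E^*_0A_i=E_0E^*_i$; (iv) $E^*_0E_0A^*_i=E^*_0E_i$.
   Context: $\mathbb{F}$ is a field, $d\ge 0$ an integer, $V$ a vector space over $\mathbb{F}$ of dimension $d+1$, $\mathrm{End}(V)$ the $\mathbb{F}$-algebra of linear maps $V\to V$; $\mathrm{tr}$ means trace. An antiautomorphism of an algebra $\mathcal{A}$ is an $\mathbb{F}$-linear bijection $\tau:\mathcal{A}\to\mathcal{A}$ with $(YZ)^\tau=Z^\tau Y^\tau$. Idempotent system on $V$: a sequence $\Phi=(\{E_i\}_{i=0}^d;\{E^*_i\}_{i=0}^d)$ of elements of $\mathrm{End}(V)$ such that $E_iE_j=\delta_{i,j}E_i$, $\mathrm{rank}(E_i)=1$, $E^*_iE^*_j=\delta_{i,j}E^*_i$, $\mathrm{rank}(E^*_i)=1$, $E_0E^*_iE_0\neq 0$, $E^*_0E_iE^*_0\ne 0$ for $0\le i,j\le d$. It is symmetric if there is an antiautomorphism $\dagger$ of $\mathrm{End}(V)$ fixing each $E_i$ and each $E^*_i$. $\mathcal{M}$ (resp. $\mathcal{M}^*$) is the subalgebra of $\mathrm{End}(V)$ generated by $\{E_i\}_{i=0}^d$ (resp. $\{E^*_i\}_{i=0}^d$),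 and these elements form a basis of it. $\nu=\mathrm{tr}(E_0E^*_0)^{-1}$ (this trace is nonzero). $\rho:\mathcal{M}\to\mathcal{M}^*$ is the unique $\mathbb{F}$-linear map with $YE^*_0E_0=Y^\rho E_0$ for all $Y\in\mathcal{M}$; $\rho^*:\mathcal{M}^*\to\mathcal{M}$ is the unique $\mathbb{F}$-linear map with $ZE_0E^*_0=Z^{\rho^*}E^*_0$ for all $Z\in\mathcal{M}^*$. For $0\le i\le d$, $A_i=\nu(E^*_i)^{\rho^*}\in\mathcal{M}$ and $A^*_i=\nu(E_i)^{\rho}\in\mathcal{M}^*$. *)

(* Defs.v *)
From HB Require Import structures.
From mathcomp Require Import all_boot all_order all_algebra all_field.

Set Implicit Arguments.
Unset Strict Implicit.
Unset Printing Implicit Defensive.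

Import GRing.Theory passmx.
Local Open Scope ring_scope.

(* End(V) for \dim V = d + 1, as an F-algebra with product f * g = f \o g (the
   usual composition of maps acting on the left).  The algebra structure that
   the library puts on 'End(V) has the opposite product, and it is only
   available under a proof that V is nonzero; whence this alias of 'End(V). *)
Definition endalg (F : fieldType) (d : nat) (V : vectType F)
  (dimV : \dim {:V} = d.+1) : Type := 'End(V).

Section EndAlgebra.
Variables (F : fieldType) (d : nat) (V : vectType F).
Hypothesis dimV : \dim {:V} = d.+1.

Local Notation A := (endalg dimV).

Lemma endalg_dim_gt0 : (0 < dim V)%N.
Proof. by rewrite -dimvf dimV. Qed.

HB.instance Definition _ := Vector.copy A 'End(V).

HB.instance Definition _ := GRing.Zmodule_isNzRing.Build A
  (@comp_lfunA F V V V V) (@comp_lfun1l F V V) (@comp_lfun1r F V V)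
  (@comp_lfunDl F V V V) (@comp_lfunDr F V V V) (lfun1_neq0 endalg_dim_gt0).

Fact endalg_scalerAl (k : F) (f g : A) : k *: (f * g) = (k *: f) * g.
Proof. exact: (@comp_lfunZl F V V V). Qed.

HB.instance Definition _ := GRing.Lmodule_isLalgebra.Build F A endalg_scalerAl.

Fact endalg_scalerAr (k : F) (f g : A) : k *: (f * g) = f * (k *: g).
Proof. exact: (@comp_lfunZr F V V V). Qed.

HB.instance Definition _ := GRing.Lalgebra_isAlgebra.Build F A endalg_scalerAr.
HB.instance Definition _ := Algebra_isFalgebra.Build F A.

Lemma endalg_mulE (f g : A) (v : V) :
  (f * g : 'End(V)) v = (f : 'End(V)) ((g : 'End(V)) v).
Proof. exact: comp_lfunE. Qed.

(* The trace is independent of the basis. *)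
Definition endtrace (f : A) : F :=
  \tr (mxof (vbasis {:V}) (vbasis {:V}) (f : 'End(V))).

Definition endrank (f : A) : nat := \dim (limg (f : 'End(V))).

End EndAlgebra.

Definition antiautomorphism (F : fieldType) (B : falgType F) (tau : B -> B) :=
  [/\ linear tau, bijective tau & forall Y Z, tau (Y * Z) = tau Z * tau Y].

(* agenv contains 1: subalgebras are unital. *)
Definition gensubalg (F : fieldType) (B : falgType F) (n : nat)
  (E : 'I_n -> B) : {aspace B} := <<<<codom E>>>>%AS.

Record idempotent_system (F : fieldType) (d : nat) (V : vectType F)
    (dimV : \dim {:V} = d.+1) := IdempotentSystem {
  idem : 'I_d.+1 -> endalg dimV;
  dual_idem : 'I_d.+1 -> endalg dimV;
  idemM i j : idem i * idem j = (i == j)%:R *: idem i;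
  idem_rank i : endrank (idem i) = 1%N;
  dual_idemM i j : dual_idem i * dual_idem j = (i == j)%:R *: dual_idem i;
  dual_idem_rank i : endrank (dual_idem i) = 1%N;
  idem0_dual_idem i : idem ord0 * dual_idem i * idem ord0 != 0;
  dual_idem0_idem i : dual_idem ord0 * idem i * dual_idem ord0 != 0
}.

Section IdempotentSystem.
Variables (F : fieldType) (d : nat) (V : vectType F).
Variable dimV : \dim {:V} = d.+1.
Implicit Type Phi : idempotent_system dimV.

Definition symmetric_system Phi : Prop :=
  exists tau : endalg dimV -> endalg dimV,
    [/\ antiautomorphism tau,
        forall i, tau (idem Phi i) = idem Phi i &
        forall i, tau (dual_idem Phi i) = dual_idem Phi i].

Definition dual_system Phi : idempotent_system dimV :=
  IdempotentSystem (dual_idemM Phi) (dual_idem_rank Phi)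
    (idemM Phi) (idem_rank Phi) (dual_idem0_idem Phi) (idem0_dual_idem Phi).

Definition idem_alg Phi := gensubalg (idem Phi).
Definition dual_idem_alg Phi := gensubalg (dual_idem Phi).

Definition nu Phi : F := (endtrace (idem Phi ord0 * dual_idem Phi ord0))^-1.

Definition rmul_on (U : {vspace endalg dimV}) (u : endalg dimV) :
    'Hom(subvs_of U, endalg dimV) := (amulr u \o linfun vsval)%VF.

Lemma rmul_onE U u (Y : subvs_of U) : rmul_on U u Y = vsval Y * u.
Proof. by rewrite comp_lfunE [in LHS]lfunE [linfun _ _]lfunE. Qed.

(* Right multiplication by E_0 is injective on M^*, and its image contains
   Y E^*_0 E_0 for every Y in M; so rho, obtained by composing right
   multiplication by E^*_0 E_0 on M with a one-sided inverse of the former, is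
   the unique linear map with Y E^*_0 E_0 = rho(Y) E_0: see rhoP, rho_unique. *)
Definition rho Phi :
    'Hom(subvs_of (idem_alg Phi), subvs_of (dual_idem_alg Phi)) :=
  ((rmul_on (dual_idem_alg Phi) (idem Phi ord0))^-1 \o
   rmul_on (idem_alg Phi) (dual_idem Phi ord0 * idem Phi ord0))%VF.

Definition dual_rho Phi :
    'Hom(subvs_of (dual_idem_alg Phi), subvs_of (idem_alg Phi)) :=
  rho (dual_system Phi).

(* vsproj U : endalg dimV -> subvs_of U is the identity on U; here it only casts
   E^*_i to M^*, and E_i to M (cf. mem_gensubalg). *)
Definition assoc_elt Phi (i : 'I_d.+1) : endalg dimV :=
  nu Phi *: vsval (dual_rho Phi (vsproj (dual_idem_alg Phi) (dual_idem Phi i))).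

Definition dual_assoc_elt Phi (i : 'I_d.+1) : endalg dimV :=
  nu Phi *: vsval (rho Phi (vsproj (idem_alg Phi) (idem Phi i))).

Lemma mem_gensubalg (E : 'I_d.+1 -> endalg dimV) i : E i \in gensubalg E.
Proof.
by apply: (subvP (sub_agenv _)); apply: memv_span; apply: codom_f.
Qed.

Lemma dual_idem_span Phi (v : V) (w : V) : v != 0 ->
  v \in limg (idem Phi ord0 : 'End(V)) ->
  exists c : 'I_d.+1 -> F,
    w = \sum_i c i *: (dual_idem Phi i : 'End(V)) v.
Proof.
move=> v0 Ev.
pose b := [tuple (dual_idem Phi i : 'End(V)) v | i < d.+1].
have lineE : limg (idem Phi ord0 : 'End(V)) = <[v]>%VS.
  apply/esym/eqP; rewrite eqEdim -memvE Ev dim_vline v0.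
  by rewrite -[X in (X <= _)%N]/(endrank (idem Phi ord0)) idem_rank.
have nz i : (dual_idem Phi i : 'End(V)) v != 0.
  apply/eqP => z; have /negP := idem0_dual_idem Phi i; apply.
  apply/eqP/lfunP => x; rewrite !endalg_mulE zero_lfunE.
  have : (idem Phi ord0 : 'End(V)) x \in <[v]>%VS by rewrite -lineE memv_img ?memvf.
  by case/vlineP=> k ->; rewrite !linearZ /= z linear0 scaler0.
have fb : free b.
  apply/freeP => k sk i.
  have := congr1 (dual_idem Phi i : 'End(V)) sk.
  rewrite linear_sum linear0 (bigD1 i) //= big1 => [|j ji].
    rewrite addr0 (nth_map i) ?size_enum_ord // nth_ord_enum linearZ /=.
    rewrite -endalg_mulE dual_idemM eqxx scale1r => /eqP.
    by rewrite scaler_eq0 (negPf (nz i)) orbF => /eqP.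
  rewrite (nth_map i) ?size_enum_ord // nth_ord_enum linearZ /=.
  by rewrite -endalg_mulE dual_idemM eq_sym (negPf ji) scale0r zero_lfunE scaler0.
have bb : basis_of fullv b by rewrite basisEfree fb subvf size_tuple dimV leqnn.
exists (fun i => coord b i w); rewrite {1}(coord_basis bb (memvf w)).
by apply: eq_bigr => i _; rewrite (nth_map i) ?size_enum_ord // nth_ord_enum.
Qed.

Lemma idem0_line Phi : exists2 v : V, v != 0 &
  limg (idem Phi ord0 : 'End(V)) = <[v]>%VS.
Proof.
have r1 : \dim (limg (idem Phi ord0 : 'End(V))) = 1%N := idem_rank Phi ord0.
exists (vpick (limg (idem Phi ord0 : 'End(V)))).
  by rewrite vpick0 -dimv_eq0 r1.
apply/esym/eqP; rewrite eqEdim -memvE memv_pick dim_vline vpick0 -dimv_eq0.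
by rewrite r1.
Qed.

Lemma rhoP Phi (Y : subvs_of (idem_alg Phi)) :
  vsval Y * dual_idem Phi ord0 * idem Phi ord0 =
  vsval (rho Phi Y) * idem Phi ord0.
Proof.
have [v v0 lineE] := idem0_line Phi.
have Ev : v \in limg (idem Phi ord0 : 'End(V)) by rewrite lineE memv_line.
set w := (vsval Y : 'End(V)) ((dual_idem Phi ord0 : 'End(V)) v).
have [c cE] := dual_idem_span w v0 Ev.
pose Z : endalg dimV := \sum_i c i *: dual_idem Phi i.
have ZM : Z \in dual_idem_alg Phi.
  by apply: memv_suml => i _; apply: memvZ; apply: mem_gensubalg.
have ZE : vsval Y * (dual_idem Phi ord0 * idem Phi ord0) = Z * idem Phi ord0.
  apply/lfunP => x; rewrite !endalg_mulE.
  have : (idem Phi ord0 : 'End(V)) x \in <[v]>%VS by rewrite -lineE memv_img ?memvf.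
  case/vlineP=> k ->; rewrite !linearZ /= -/w cE; congr (_ *: _).
  by rewrite sum_lfunE; apply: eq_bigr => i _; rewrite scale_lfunE.
have im : vsval Y * (dual_idem Phi ord0 * idem Phi ord0) \in
    limg (rmul_on (dual_idem_alg Phi) (idem Phi ord0)).
  rewrite ZE; apply/memv_imgP; exists (Subvs ZM); first exact: memvf.
  by rewrite rmul_onE.
have := limg_lfunVK im; rewrite rmul_onE mulrA => <-; congr (vsval _ * _).
by rewrite -mulrA -[in LHS]rmul_onE -[LHS]comp_lfunE.
Qed.

Lemma dual_idem_alg_comm Phi (Z : endalg dimV) i :
  Z \in dual_idem_alg Phi -> Z * dual_idem Phi i = dual_idem Phi i * Z.
Proof.
move=> ZM; apply/cent1vP; move: ZM; apply/subvP.
have SC : (<<codom (dual_idem Phi)>> <= 'C[dual_idem Phi i])%VS.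
  apply/span_subvP => _ /codomP[j ->]; apply/cent1vP.
  by rewrite !dual_idemM [j == i]eq_sym; case: eqP => [->|]; rewrite ?scale0r.
apply: agenv_sub_modl; first by rewrite -memvE cent1v1.
by apply: subv_trans (prodvSl _ SC) _; rewrite prodv_id.
Qed.

Lemma rho_unique Phi
    (r : 'Hom(subvs_of (idem_alg Phi), subvs_of (dual_idem_alg Phi))) :
  (forall Y, vsval Y * dual_idem Phi ord0 * idem Phi ord0 =
             vsval (r Y) * idem Phi ord0) -> r = rho Phi.
Proof.
move=> rP; apply/lfunP => Y; apply/eqP; rewrite -subr_eq0.
set Z := r Y - rho Phi Y.
have ZE : vsval Z * idem Phi ord0 = 0.
  by rewrite linearB /= mulrBl -rP -rhoP subrr.
have [v v0 lineE] := idem0_line Phi.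
have Ev : v \in limg (idem Phi ord0 : 'End(V)) by rewrite lineE memv_line.
have Zv : (vsval Z : 'End(V)) v = 0.
  have /memv_imgP[x _ ->] := Ev.
  by rewrite -endalg_mulE ZE zero_lfunE.
suff Z0 : vsval Z = 0 by apply/eqP/val_inj; exact: Z0.
apply/lfunP => w; rewrite zero_lfunE.
have [c ->] := dual_idem_span w v0 Ev.
rewrite linear_sum big1 // => i _; rewrite linearZ /= -endalg_mulE.
have -> := dual_idem_alg_comm i (subvsP Z).
by have -> := endalg_mulE (dual_idem Phi i) (vsval Z) v; rewrite Zv linear0 scaler0.
Qed.

End IdempotentSystem.

(* Main.v *)
From HB Require Import structures.
Require Import Defs.
From mathcomp Require Import all_boot all_order all_algebra all_field.

Import GRing.Theory passmx.
Local Open Scope ring_scope.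

(** For (i), the definition of the map from M^* to M gives
    A_i E^*_0 = nu E^*_i E_0 E^*_0, and hence
    A_i E^*_0 E_0 = nu E^*_i (E_0 E^*_0 E_0).  Since E_0 has rank one, the
    bracket is the multiple tr(E_0 E^*_0) E_0 of E_0 ([rank1_sandwich]), and nu
    was chosen to cancel the trace, which is nonzero because E_0 E^*_0 E_0 is
    ([assoc_elt_idem0]).  Part (ii) is part (i) for the dual system: exchanging
    the two families of idempotents leaves nu unchanged, as tr(XY) = tr(YX).

    Parts (iii) and (iv) are the images of (i) and (ii) under the
    antiautomorphism that the symmetry of the system provides.  It fixes A_i,
    because it fixes the whole of M: it fixes the generators E_i of M, and as
    these commute with everything in M, reversing the order of the factors of a
    product of generators does not change the product
    ([antiautomorphism_fix_gensubalg]). *)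

(** * Rank one endomorphisms *)

Section Endomorphisms.
Variables (F : fieldType) (d : nat) (V : vectType F).
Variable dimV : \dim {:V} = d.+1.
Implicit Types a x y : endalg dimV.

(** The product is reversed because matrices act on row vectors. *)
Lemma mxof_endalgM a x (b := vbasis {:V}) :
  mxof b b (a * x : endalg dimV) = mxof b b x *m mxof b b a.
Proof. exact: mxof_comp (vbasisP _) _ _. Qed.

Lemma endtraceC x y : endtrace (x * y) = endtrace (y * x).
Proof. by rewrite /endtrace !mxof_endalgM mxtrace_mulC. Qed.

(** The matrix of a rank one map is a column c times a row r, so with N the
    matrix of x both sides come from
    c r N c r = (r N c) c r and tr(N c r) = r N c. *)
Lemma rank1_sandwich a x :
  endrank a = 1%N -> a * x * a = endtrace (a * x) *: a.
Proof.
move=> rank_a; set b := vbasis {:V}.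
pose v := vpick (limg (a : 'End(V))).
have line_a : limg (a : 'End(V)) = <[v]>%VS.
  apply/esym/eqP; rewrite eqEdim -memvE memv_pick dim_vline vpick0 -dimv_eq0.
  by rewrite [\dim _]rank_a.
have /submxP[c mx_a] : (mxof b b a <= rVof b v)%MS.
  apply/row_subP => i; rewrite rowE mul_mxof //.
  have : (a : 'End(V)) (vecof b (delta_mx 0 i)) \in <[v]>%VS.
    by rewrite -line_a memv_img ?memvf.
  by case/vlineP => k ->; rewrite linearZ scalemx_sub.
apply: (can_inj (mxofK (vbasisP _) (vbasisP _))).
rewrite [RHS]linearZ /= /endtrace !mxof_endalgM -/b mx_a.
set r := rVof b v; set N := mxof b b x.
rewrite !mulmxA [in RHS]mxtrace_mulC trace_mx11 -!mulmxA (mulmxA N) (mulmxA r).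
by rewrite {1}[r *m _]mx11_scalar mul_scalar_mx -scalemxAr.
Qed.

End Endomorphisms.

(** * Antiautomorphisms and generated subalgebras *)

Lemma antiautomorphism1 {F : fieldType} {B : falgType F} {tau : B -> B} :
  antiautomorphism tau -> tau 1 = 1.
Proof.
case=> _ [sigma _ tauK] tauM.
by rewrite -[LHS]mul1r -{1}[1]tauK -tauM mul1r tauK.
Qed.

(** Multiplying a fixed element Y of the algebra by a generator E_j gives a
    fixed element, as tau(E_j Y) = tau(Y) tau(E_j) = Y E_j = E_j Y. *)
Lemma antiautomorphism_fix_gensubalg {F : fieldType} {B : falgType F} {n : nat}
    {E : 'I_n -> B} {tau : B -> B} :
    antiautomorphism tau -> (forall i, tau (E i) = E i) ->
    (forall i Y, Y \in gensubalg E -> Y * E i = E i * Y) ->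
  {in gensubalg E, forall Y, tau Y = Y}.
Proof.
move=> antitau tauE commE.
have tau1 := antiautomorphism1 antitau.
case: antitau => tau_lin _ tauM.
pose tau_mixin := GRing.isLinear.Build F B B *:%R tau tau_lin.
pose tauL : {linear B -> B} := HB.pack tau tau_mixin.
pose fixed := (lker (linfun tauL - \1)%VF :&: gensubalg E)%VS.
have fixedP Y : (Y \in fixed) = (tau Y == Y) && (Y \in gensubalg E).
  by rewrite memv_cap memv_ker add_lfunE opp_lfunE id_lfunE lfunE subr_eq0.
suff sub_fixed : (gensubalg E <= fixed)%VS.
  by move=> Y /(subvP sub_fixed); rewrite fixedP => /andP[/eqP].
apply: agenv_sub_modl.
  by rewrite -memvE fixedP tau1 eqxx (subvP (sub1_agenv _)) ?memv_line.
apply/prodvP => X Y spanX; rewrite fixedP => /andP[/eqP tauY memY].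
have memX : X \in gensubalg E by rewrite (subvP (sub_agenv _)).
rewrite fixedP tauM tauY memvM // andbT.
(* For fixed Y, the identity to be shown is linear in X. *)
pose comm_with_Y := lker (amull Y \o linfun tauL - amulr Y)%VF.
have commP Z : (Z \in comm_with_Y) = (Y * tau Z == Z * Y).
  by rewrite memv_ker add_lfunE opp_lfunE comp_lfunE 3!lfunE subr_eq0.
suff /subvP/(_ X spanX) : (<<codom E>> <= comm_with_Y)%VS by rewrite commP.
by apply/span_subvP => _ /codomP[i ->]; rewrite commP tauE commE.
Qed.

(** * The associated elements of an idempotent system *)

Section IdempotentSystem.
Context {F : fieldType} {d : nat} {V : vectType F} {dimV : \dim {:V} = d.+1}.
Implicit Type Phi : idempotent_system dimV.

Lemma nu_dual Phi : nu (dual_system Phi) = nu Phi.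
Proof. by rewrite /nu endtraceC. Qed.

Lemma dual_assoc_eltE Phi i :
  dual_assoc_elt Phi i = assoc_elt (dual_system Phi) i.
Proof. by rewrite /assoc_elt nu_dual; case: Phi. Qed.

Lemma symmetric_dual {Phi} :
  symmetric_system Phi -> symmetric_system (dual_system Phi).
Proof. by case=> tau [? ? ?]; exists tau. Qed.

Lemma endtrace_idem0_neq0 Phi :
  endtrace (idem Phi ord0 * dual_idem Phi ord0) != 0.
Proof.
apply: contraNneq (idem0_dual_idem Phi ord0) => tr0.
by rewrite rank1_sandwich ?idem_rank // tr0 scale0r.
Qed.

Lemma assoc_elt_idem0 Phi i :
  assoc_elt Phi i * dual_idem Phi ord0 * idem Phi ord0
    = dual_idem Phi i * idem Phi ord0.
Proof.
have := rhoP (vsproj (idem_alg (dual_system Phi)) (dual_idem Phi i)).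
rewrite vsprojK ?(mem_gensubalg (dual_idem Phi)) //= => rhoE.
rewrite /assoc_elt -!scalerAl -[X in _ *: (X * _)]rhoE -!mulrA [idem _ _ * _]mulrA.
rewrite rank1_sandwich ?idem_rank // -scalerAr scalerA mulVf ?scale1r //.
exact: endtrace_idem0_neq0.
Qed.

Lemma idem0_assoc_elt Phi i : symmetric_system Phi ->
  idem Phi ord0 * dual_idem Phi ord0 * assoc_elt Phi i
    = idem Phi ord0 * dual_idem Phi i.
Proof.
case=> tau [antitau tauE tauEs].
have memA : assoc_elt Phi i \in gensubalg (idem Phi) by rewrite rpredZ ?subvsP.
(* M is the dual algebra of the dual system; hence its commutativity. *)
have tauA := antiautomorphism_fix_gensubalg antitau tauE
  (fun j Y => @dual_idem_alg_comm _ _ _ _ (dual_system Phi) Y j) _ memA.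
case: antitau => _ _ tauM; have := congr1 tau (assoc_elt_idem0 Phi i).
by rewrite !tauM tauA !tauE !tauEs mulrA.
Qed.

End IdempotentSystem.

Theorem lemma7p4 (F : fieldType) (d : nat) (V : vectType F)
    (dimV : \dim {:V} = d.+1) (Phi : idempotent_system dimV)
    (Phi_sym : symmetric_system Phi) (i : 'I_d.+1) :
  [/\ assoc_elt Phi i * dual_idem Phi ord0 * idem Phi ord0
        = dual_idem Phi i * idem Phi ord0,
      dual_assoc_elt Phi i * idem Phi ord0 * dual_idem Phi ord0
        = idem Phi i * dual_idem Phi ord0,
      idem Phi ord0 * dual_idem Phi ord0 * assoc_elt Phi i
        = idem Phi ord0 * dual_idem Phi i &
      dual_idem Phi ord0 * idem Phi ord0 * dual_assoc_elt Phi i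
        = dual_idem Phi ord0 * idem Phi i].
Proof.
rewrite !dual_assoc_eltE; split.
- exact: assoc_elt_idem0.
- exact: (assoc_elt_idem0 (dual_system Phi)).
- exact: idem0_assoc_elt.
- exact: (idem0_assoc_elt (dual_system Phi) i (symmetric_dual Phi_sym)).
Qed.
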